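(* Let $(C,\Omega)$ be a regular chain complex over a principal ring $R$, finite of order $d$. For $0\leq i\leq d$, every $i$-skeleton $\operatorname{sk}_i(C)$ of $C$ is regular.
   Context: A principal ring $R$ is an integral domain (commutative with $1$) all of whose ideals are principal. **Chain complexes.** A chain complex $(C,\Omega)$ over $R$ consists of free $R$-modules $C_\nu$ ($\nu\geq 0$), each with a fixed finite (possibly empty) basis $\Omega_\nu=\{e^\nu_1,\ldots,e^\nu_{k_\nu}\}$, and $R$-linear maps $\partial_\nu\colon C_\nu\to C_{\nu-1}$ ($\nu\geq1$), $\partial_0\colon C_0\to 0$, with $\partial_\nu\circ\partial_{\nu+1}=0$; $\Omega=\bigcup_\nu\Omega_\nu$. The bases are fixed; only permutations of their elements are allowed. It is finite of order $d$ if $C_\nu=0$ for $\nu>d$ and $C_d\neq0$. For $x=\sum_i a_ie^\nu_i\in C_\nu$, $\operatorname{supp}(x)=\{e^\nu_i\mid a_i\neq0\}$ and $\operatorname{bd}(x)=\operatorname{supp}(\partial_\nu x)$. The $i$-skeleton $\operatorname{sk}_i(C)$ is the subcomplex with chain modules $C_\nu$ (basis $\Omega_\nu$) for $0\leq\nu\leq i$ and $0$ for $\nu>i$. A finite complex of order $d$ is pure if every $e\in\Omega_\nu$, $0\leq\nu\leq d-1$, lies in $\operatorname{bd}(f)$ for some $f\in\Omega_{\nu+1}$. A basis element is maximal if it lies in $\operatorname{bd}(f)$ for no $f\in\Omega$; $\Gamma$ is the set of all maximal basis elements. For $e\in\Omega_\mu$ the subcomplex $(C_e,\Omega_e)$ has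 bases $(\Omega_e)_\nu=\emptyset$ for $\nu>\mu$, $(\Omega_e)_\mu=\{e\}$, and $(\Omega_e)_\nu=\bigcup_{f\in(\Omega_e)_{\nu+1}}\operatorname{bd}(f)$ for $0\leq\nu\leq\mu-1$. Put $s(e)=\mu$. A subset $T\subset\Omega$ such that $\Omega_e\subset T$ for all $e\in T$ generates the subcomplex with basis $T$; $T_\nu=T\cap\Omega_\nu$. **Shellings** (recursive in $d$). Let $(C,\Omega)$ be finite of order $d$ with $\Gamma\neq\emptyset$. An order $g_1,\ldots,g_k$ of the elements of $\Gamma$ is a shelling if $d=0$, or if $d\geq1$ and: (S1) for $2\leq j\leq k$ the set $\Omega_{g_j}\cap\bigcup_{i=1}^{j-1}\Omega_{g_i}$ generates a pure chain complex of order $s(g_j)-1$; (S2) for $2\leq j\leq k$ the set $(\Omega_{g_j})_{s(g_j)-1}$ has a shelling in which the elements of $\bigl(\Omega_{g_j}\cap\bigcup_{i=1}^{j-1}\Omega_{g_i}\bigr)_{s(g_j)-1}$ come first; (S3) $(\Omega_{g_1})_{s(g_1)-1}$ has a shelling. Here (S1), (S2) are regarded as satisfied when $s(g_j)=0$, and for $s(g)\geq1$ a shelling of $(\Omega_g)_{s(g)-1}=\operatorname{bd}(g)$ means a shelling of $\operatorname{sk}_{s(g)-1}(C_g)$, whose maximal elements are exactly the elements of $\operatorname{bd}(g)$. $(C,\Omega)$ is shellable if a shelling exists. A shelling is monotonically descending if $s(g_i)\geq s(g_{i+1})$ for all $i$. **Regularity.** Let $(C,\Omega)$ be shellable of order $d$.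 Let each $\Omega_\nu=\{e^\nu_1,\ldots,e^\nu_{k_\nu}\}$ be ordered with $\Gamma\cap\Omega_\nu=\{e^\nu_{m_\nu+1},\ldots,e^\nu_{k_\nu}\}$ (so $m_d=0$), such that $\Gamma$, listed as $e^d_1,\ldots,e^d_{k_d},e^{d-1}_{m_{d-1}+1},\ldots,e^{d-1}_{k_{d-1}},\ldots,e^0_{m_0+1},\ldots,e^0_{k_0}$, is a monotonically descending shelling. For every $e^\nu_\ell$ with $\nu\geq1$ let $\operatorname{bd}(e^\nu_\ell)=\{f^{\nu-1}_1,\ldots,f^{\nu-1}_{n_\ell}\}$ be ordered as a shelling in which the elements of $(\bigcup_{i=1}^{\ell-1}\Omega_{e^\nu_i})\cap\Omega_{e^\nu_\ell}$ come first. For $0\leq\nu\leq d-1$ the order of $\Omega_\nu$ is: first $\operatorname{bd}(e^{\nu+1}_1)$ in its shelling order; then, for $i=2,3,\ldots$ successively, the elements of $\operatorname{bd}(e^{\nu+1}_i)$ lying in no $\operatorname{bd}(e^{\nu+1}_\ell)$, $\ell<i$, in the order of the shelling of $\operatorname{bd}(e^{\nu+1}_i)$; finally $\Gamma\cap\Omega_\nu$ in the same order as in $\Gamma$. $\Gamma$ has a regular order (and $(C,\Omega)$ is regular) if such orderings can be chosen so that: (R1) for every $e^\nu_\ell\in\Gamma$, if $\operatorname{bd}(e^\nu_\ell)\subset\bigcup_{i=1}^{\ell-1}\operatorname{bd}(e^\nu_i)$, then there are $a_1,\ldots,a_\ell\in R$, $a_\ell\neq0$, with $a_\ell\partial_\nu(e^\nu_\ell)=\sum_{i=1}^{\ell-1}a_i\partial_\nu(e^\nu_i)$;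 (R2) for every $e^\nu_\ell\in\Omega_\nu$, $\nu\geq1$, and every $1\leq j\leq n_\ell$, if $\operatorname{bd}(f^{\nu-1}_j)\subset\bigcup_{i=1}^{j-1}\operatorname{bd}(f^{\nu-1}_i)$, then there are $c_1,\ldots,c_j\in R$, $c_j\neq0$, with $c_j\partial_{\nu-1}(f^{\nu-1}_j)=\sum_{i=1}^{j-1}c_i\partial_{\nu-1}(f^{\nu-1}_i)$. (Empty sums are $0$.) *)

(* Defs.v *)
From HB Require Import structures.
From mathcomp Require Import all_boot all_order all_algebra.

Set Implicit Arguments.
Unset Strict Implicit.
Unset Printing Implicit Defensive.

Import GRing.Theory.
Local Open Scope ring_scope.

(* Ideals are arbitrary (Prop-valued) subsets, the zero and unit ideals
   included. *)
Definition ideal (R : idomainType) (I : R -> Prop) : Prop :=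
  [/\ I 0, forall x y, I x -> I y -> I (x + y) & forall r x, I x -> I (r * x)].

Definition principal_ring (R : idomainType) : Prop :=
  forall I : R -> Prop, ideal I ->
    exists a : R, forall x, I x <-> exists r, x = r * a.

(* The free module C_n is identified with the row vectors R^(rk n) through its
   fixed basis; the basis elements are the indices in 'I_(rk n). *)
Record chain_complex (R : idomainType) := ChainComplex {
  rk : nat -> nat;
  diff : forall n, {linear 'rV[R]_(rk n.+1) -> 'rV[R]_(rk n)};
  diff_diff : forall n (x : 'rV[R]_(rk n.+2)), diff n (diff n.+1 x) = 0
}.

Section Complexes.
Variables (R : idomainType) (C : chain_complex R).

(* In degree 0 this is the zero map; its target C_(0.-1) = C_0 is only a
   placeholder for the zero module. *)
Definition boundary n : 'rV[R]_(rk C n) -> 'rV[R]_(rk C n.-1) :=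
  match n return 'rV[R]_(rk C n) -> 'rV[R]_(rk C n.-1) with
  | 0 => fun=> 0
  | n'.+1 => diff C n'
  end.

Definition supp n (x : 'rV[R]_(rk C n)) : {set 'I_(rk C n)} :=
  [set i | x 0 i != 0].

Definition bdry n (e : 'I_(rk C n)) : 'rV[R]_(rk C n.-1) :=
  boundary (delta_mx 0 e).

Definition bdn n (e : 'I_(rk C n)) : {set 'I_(rk C n.-1)} := supp (bdry e).

(* The disjoint union of the bases over all degrees. *)
Definition cell : Type := {n : nat & 'I_(rk C n)}.

Definition Cell n (e : 'I_(rk C n)) : cell := existT _ n e.

Definition deg (e : cell) : nat := tag e.

Definition bd (e : cell) : seq cell :=
  [seq @Cell (tag e).-1 f | f <- enum (bdn (tagged e))].

(* The basis elements of degree [deg e - k] of the subcomplex C_e. *)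
Fixpoint face_layer (e : cell) (k : nat) : seq cell :=
  if k is k'.+1 then flatten [seq bd f | f <- face_layer e k'] else [:: e].

(* The basis Omega_e of C_e. *)
Definition faces (e : cell) : {pred cell} :=
  [pred f | (deg f <= deg e)%N && (f \in face_layer e (deg e - deg f))].

(* The subcomplex generated by a set T of basis elements is represented by T:
   its differential is the restriction of that of C, so that supports and
   boundaries computed in the subcomplex and in C agree. *)
Record subcomplex := Subcomplex {
  basis :> {pred cell};
  basis_closed : forall e f, e \in basis -> f \in faces e -> f \in basis
}.

Definition full : subcomplex :=
  @Subcomplex predT (fun _ _ _ _ => isT).

Lemma face_layer_trans e f g k l :
  f \in face_layer e k -> g \in face_layer f l -> g \in face_layer e (l + k).
Proof.
move=> fe; elim: l g => [|l IH] g /=; first by rewrite inE => /eqP ->.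
by case/flatten_mapP => h hf gh; apply/flatten_mapP; exists h; first exact: IH.
Qed.

Lemma faces_trans e f g : f \in faces e -> g \in faces f -> g \in faces e.
Proof.
rewrite !inE => /andP[le_fe fe] /andP[le_gf gf].
rewrite (leq_trans le_gf le_fe) /=.
have -> : (deg e - deg g = (deg f - deg g) + (deg e - deg f))%N.
  by rewrite addnC addnBA // subnK.
exact: face_layer_trans fe gf.
Qed.

(* The subcomplex C_e. *)
Definition cell_complex (e : cell) : subcomplex :=
  @Subcomplex (faces e) (@faces_trans e).

Lemma skeleton_closed (i : nat) (K : subcomplex) e f :
  e \in [pred x | (x \in K) && (deg x <= i)%N] -> f \in faces e ->
  f \in [pred x | (x \in K) && (deg x <= i)%N].
Proof.
rewrite !inE => /andP[eK le_ei] fe; rewrite (basis_closed eK fe) /=.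
by case/andP: fe => le_fe _; apply: leq_trans le_ei.
Qed.

Definition skeleton (i : nat) (K : subcomplex) : subcomplex :=
  Subcomplex (@skeleton_closed i K).

Lemma attaching_closed (s : seq cell) (g : cell) e f :
  e \in [pred x | (x \in faces g) && has (fun h => x \in faces h) s] ->
  f \in faces e ->
  f \in [pred x | (x \in faces g) && has (fun h => x \in faces h) s].
Proof.
rewrite !inE => /andP[eg /hasP[h hs eh]] fe.
apply/andP; split; first exact: faces_trans eg fe.
by apply/hasP; exists h => //; apply: faces_trans eh fe.
Qed.

(* The subcomplex generated by the intersection of Omega_g with the union of
   the Omega_h, h in s. *)
Definition attaching (s : seq cell) (g : cell) : subcomplex :=
  Subcomplex (@attaching_closed s g).

Definition has_order (K : subcomplex) (d : nat) : Prop :=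
  (exists2 e, e \in K & deg e = d) /\ (forall e, e \in K -> (deg e <= d)%N).

Definition pure (K : subcomplex) (d : nat) : Prop :=
  has_order K d /\
  (forall e, e \in K -> (deg e < d)%N -> exists2 f, f \in K & e \in bd f).

Definition maximal (K : subcomplex) (e : cell) : Prop :=
  e \in K /\ (forall f, f \in K -> e \notin bd f).

(* g lists the (nonempty) set of maximal elements of K without repetition. *)
Definition orders_maximal (K : subcomplex) (g : seq cell) : Prop :=
  [/\ g != [::], uniq g & forall e, e \in g <-> maximal K e].

(* The elements preceding x in a duplicate-free sequence s. *)
Definition before (T : eqType) (s : seq T) (x : T) : seq T :=
  take (index x s) s.

Definition come_first (T : eqType) (A : {pred T}) (s : seq T) : Prop :=
  s = [seq x <- s | x \in A] ++ [seq x <- s | x \notin A].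

(* A shelling of bd(g) is a shelling of this complex. *)
Definition bd_complex (g : cell) : subcomplex :=
  skeleton (deg g).-1 (cell_complex g).

(* All conditions on a maximal element of degree 0 are void. For the first
   element this is harmless: if d > 0 and a maximal element of degree 0 comes
   first, the purity condition fails at the first element of positive
   degree. *)
Inductive shelling : subcomplex -> seq cell -> Prop :=
| Shelling0 K g of has_order K 0 & orders_maximal K g : shelling K g
| ShellingS K g d of (0 < d)%N & has_order K d & orders_maximal K g &
    (forall x : cell, x \in g -> before g x != [::] -> (0 < deg x)%N ->
       pure (attaching (before g x) x) (deg x).-1) &
    (forall x : cell, x \in g -> before g x != [::] -> (0 < deg x)%N ->
       exists2 t, shelling (bd_complex x) t
                & come_first (attaching (before g x) x) t) &
    (forall x : cell, x \in g -> before g x = [::] -> (0 < deg x)%N ->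
       exists t, shelling (bd_complex x) t) :
  shelling K g.

Definition descending (g : seq cell) : Prop :=
  sorted (fun e f => (deg f <= deg e)%N) g.

(* The maximal elements in decreasing degrees d, ..., 0, those of degree n
   being the elements of o n from position m n on. *)
Definition maximal_list (d : nat) (o : forall n, seq 'I_(rk C n))
    (m : nat -> nat) : seq cell :=
  flatten [seq [seq Cell e | e <- drop (m n) (o n)] | n <- rev (iota 0 d.+1)].

(* For each e in s successively, the elements of bd(e), in the order b e, that
   lie in the boundary of no earlier element of s. *)
Definition induced_order n (s : seq 'I_(rk C n))
    (b : 'I_(rk C n) -> seq 'I_(rk C n.-1)) : seq 'I_(rk C n.-1) :=
  flatten [seq [seq f <- b e | all (fun e' => f \notin bdn e') (before s e)]
          | e <- s].

(* s is meant to be duplicate-free and not to contain e. *)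
Definition dependent_if_covered n (s : seq 'I_(rk C n)) (e : 'I_(rk C n)) :
    Prop :=
  (forall f, f \in bdn e -> exists2 e', e' \in s & f \in bdn e') ->
  exists a : 'I_(rk C n) -> R,
    a e != 0 /\ a e *: bdry e = \sum_(e' <- s) a e' *: bdry e'.

(* o n is the order of the basis in degree n, whose first m n elements are the
   non-maximal ones, and b n e (n >= 1) is the order of bd(e). *)
Record regular_orders (K : subcomplex) (d : nat)
    (o : forall n, seq 'I_(rk C n)) (m : nat -> nat)
    (b : forall n, 'I_(rk C n) -> seq 'I_(rk C n.-1)) : Prop := {
  order_uniq : forall n, uniq (o n);
  order_mem : forall n (e : 'I_(rk C n)), (e \in o n) = (Cell e \in K);
  order_split : forall n, (m n <= size (o n))%N;
  order_maximal : forall n (e : 'I_(rk C n)),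
    e \in o n -> (e \in drop (m n) (o n) <-> maximal K (Cell e));
  maximal_shelling : shelling K (maximal_list d o m);
  maximal_descending : descending (maximal_list d o m);
  bd_shelling : forall n (e : 'I_(rk C n)), (0 < n)%N -> e \in o n ->
    shelling (bd_complex (Cell e)) [seq Cell f | f <- b n e];
  bd_come_first : forall n (e : 'I_(rk C n)), (0 < n)%N -> e \in o n ->
    come_first (attaching [seq Cell e' | e' <- before (o n) e] (Cell e))
               [seq Cell f | f <- b n e];
  order_induced : forall n, (n < d)%N ->
    o n = induced_order (o n.+1) (b n.+1) ++ drop (m n) (o n);
  maximal_dependent : forall n (e : 'I_(rk C n)),
    e \in o n -> maximal K (Cell e) ->
    dependent_if_covered (before (o n) e) e;
  bd_dependent : forall n (e : 'I_(rk C n)) (f : 'I_(rk C n.-1)),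
    (0 < n)%N -> e \in o n -> f \in b n e ->
    dependent_if_covered (before (b n e) f) f
}.

Definition regular (K : subcomplex) : Prop :=
  exists d o m b, has_order K d /\ @regular_orders K d o m b.

End Complexes.

(* Main.v *)
Require Import Defs.
From mathcomp Require Import all_boot all_order all_algebra.

(** It is enough to pass from a regular complex K of order d+1 to its
    d-skeleton and to iterate. All orders of K in degrees up to d are kept, and
    so are the orders of the boundaries; in the skeleton every basis element of
    degree d has become maximal.

    Write the order of the basis in degree d as the ridges (the elements in
    the boundary of some facet, a basis element of degree d+1) followed by the
    elements that were already maximal in K. The new list of maximal elements
    is the old one with the block of facets replaced by the block of ridges.
    The union of the Omega_r over all ridges r differs from the union over all
    facets by the facets only, so for the old maximal elements the subcomplex
    along which they are attached is unchanged, and so are their shelling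
    conditions ([skeleton_shelling]).

    The point is to treat a ridge x ([ridge_attaching]). Let e be the first
    facet with x in bd(e). The ridges before x are those in the boundary of an
    earlier facet, and those coming before x in the shelling of bd(e)
    ([induced_order_before]). Suppose that x shares a face f with a ridge of an
    earlier facet. Then f lies in the intersection of Omega_e with the union of
    the Omega_e' over the earlier facets e', and since (S1) at e says that this
    intersection is pure of order d, f is a face of a ridge z of e lying in the
    boundary of an earlier facet. These come first in the shelling of bd(e), so
    z precedes x there, as x is new. Hence x is attached along the same
    subcomplex in the order of the ridges as in the shelling of bd(e), from
    which it inherits its shelling conditions. The same comparison shows that
    bd(x) is covered by the ridges before x only if it is covered by those
    before x in bd(e), so (R2) for bd(e) gives the linear relation demanded by
    (R1) in the skeleton ([ridge_dependent]). *)

Set Implicit Arguments.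
Unset Strict Implicit.
Unset Printing Implicit Defensive.

Import GRing.Theory.
Local Open Scope ring_scope.

(** * Initial segments of sequences *)

Section Before.
Variable T : eqType.
Implicit Types (s : seq T) (x y : T).

Lemma before_notin s x : x \notin before s x.
Proof.
have [xs|xs] := boolP (x \in s); last by apply: contra xs; apply: mem_take.
by rewrite /before in_take // ltnn.
Qed.

Lemma before_cat_in s1 s2 x : x \in s1 -> before (s1 ++ s2) x = before s1 x.
Proof.
by move=> xs; rewrite /before index_cat xs take_cat index_mem xs.
Qed.

Lemma before_cat_notin s1 s2 x :
  x \notin s1 -> before (s1 ++ s2) x = s1 ++ before s2 x.
Proof.
move=> xs; rewrite /before index_cat (negbTE xs) take_cat.
by rewrite ltnNge leq_addr /= addKn.
Qed.

Lemma before_filter (p : pred T) s x :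
  p x -> before (filter p s) x = filter p (before s x).
Proof.
move=> px; elim: s => //= y s IHs; rewrite /before /=.
have [eyx|nyx] := eqVneq y x; first by rewrite eyx px /= eqxx.
by case: ifP => py; rewrite /= ?(negbTE nyx) /= py -IHs.
Qed.

Lemma come_first_before (A : {pred T}) s x y :
  come_first A s -> x \notin A -> y \in s -> y \in A -> y \in before s x.
Proof.
move=> -> xA + yA; rewrite mem_cat !mem_filter yA /= orbF => ys.
by rewrite before_cat_notin ?mem_cat ?mem_filter ?(negbTE xA) // yA ys.
Qed.

Lemma eq_come_first (A B : {pred T}) s :
  A =i B -> come_first A s -> come_first B s.
Proof.
move=> eAB; rewrite /come_first (eq_filter eAB).
by congr (_ = _ ++ _); apply: eq_filter => x; rewrite eAB.
Qed.

End Before.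

Lemma before_map (T U : eqType) (f : T -> U) (s : seq T) (x : T) :
  injective f -> before (map f s) (f x) = map f (before s x).
Proof. by move=> f_inj; rewrite /before index_map // map_take. Qed.

(** * Faces, pure complexes and shellings *)

Section Skeleta.
Variables (R : idomainType) (C : chain_complex R).
Implicit Types (K : subcomplex C) (e f g h x y z : cell C).

Lemma Cell_inj n : injective (@Cell R C n).
Proof. by move=> i j /eqP; rewrite eq_Tagged => /eqP. Qed.

Lemma deg_bd e f : f \in bd e -> deg e = (deg f).+1.
Proof.
case: e => [[|n] e] /mapP[i]; last by move=> _ ->.
by rewrite mem_enum inE /bdry /= mxE eqxx.
Qed.

Lemma mem_bd n (e : 'I_(rk C n.+1)) (f : 'I_(rk C n)) :
  (Cell f \in bd (Cell e)) = (f \in bdn e).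
Proof. by rewrite /bd /= (mem_map (@Cell_inj n)) mem_enum. Qed.

Lemma face_layer_deg e f k : f \in face_layer e k -> deg e = (deg f + k)%N.
Proof.
elim: k f => [|k IHk] f /=; first by rewrite inE addn0 => /eqP ->.
by case/flatten_mapP => h /IHk -> /deg_bd ->; rewrite addSnnS.
Qed.

Lemma mem_facesP e f : reflect (exists k, f \in face_layer e k) (f \in faces e).
Proof.
apply: (iffP idP) => [/andP[_ fe]|[k fe]]; first by exists (deg e - deg f)%N.
rewrite inE (face_layer_deg fe) leq_addr addKn.
exact: fe.
Qed.

Lemma faces_refl e : e \in faces e.
Proof. by apply/mem_facesP; exists 0%N; rewrite inE. Qed.

Lemma bd_faces e f : f \in bd e -> f \in faces e.
Proof. by move=> fe; apply/mem_facesP; exists 1%N; rewrite /= cats0. Qed.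

Lemma faces_deg e f : f \in faces e -> (deg f <= deg e)%N.
Proof. by case/andP. Qed.

Lemma faces_deg_eq e f : f \in faces e -> deg f = deg e -> f = e.
Proof.
by case/andP=> _ + eqd; rewrite eqd subnn inE => /eqP.
Qed.

Lemma faces_bd_first e f :
  f \in faces e -> (deg f < deg e)%N -> exists2 h, h \in bd e & f \in faces h.
Proof.
move=> /mem_facesP[k]; elim: k f => [|k IHk] f fe.
  by rewrite (face_layer_deg fe) addn0 ltnn.
case/flatten_mapP: fe => h he fh _.
have [eqd|ned] := eqVneq (deg h) (deg e).
  exists f; last exact: faces_refl.
  by rewrite -(faces_deg_eq _ eqd) //; apply/mem_facesP; exists k.
have lt_he : (deg h < deg e)%N.
  by rewrite ltn_neqAle ned (face_layer_deg he) leq_addr.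
have [h' h'e hh'] := IHk _ he lt_he.
by exists h' => //; apply: faces_trans hh' (bd_faces fh).
Qed.

Lemma mem_faces_bdn n (e : 'I_(rk C n.+1)) (f : 'I_(rk C n)) :
  (Cell f \in faces (Cell e)) = (f \in bdn e).
Proof.
rewrite -mem_bd; apply/idP/idP => [fe|]; last exact: bd_faces.
have [//|h he fh] := faces_bd_first fe.
suff -> : Cell f = h by [].
by apply: faces_deg_eq fh _; apply/eqP; rewrite -eqSS -(deg_bd he).
Qed.

Lemma mem_faces_bdn_pred n (x z : 'I_(rk C n)) (f : 'I_(rk C n.-1)) :
  f \in bdn x -> (Cell f \in faces (Cell z)) = (f \in bdn z).
Proof.
case: n x z f => [|n] x z f; last by rewrite mem_faces_bdn.
by rewrite inE /bdry /= mxE eqxx.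
Qed.

Lemma faces_codim1 n (e : 'I_(rk C n.+1)) z :
  z \in faces (Cell e) -> deg z = n -> exists2 f, z = Cell f & f \in bdn e.
Proof.
case: z => k f ze /= ek; rewrite /deg /= in ek; case: _ / ek e ze => e ze.
by exists f => //; rewrite -mem_faces_bdn.
Qed.

(** Purity allows climbing from f through boundaries up to the top degree. *)
Lemma pure_top K n f :
  pure K n -> f \in K -> exists z, [/\ z \in K, deg z = n & f \in faces z].
Proof.
move=> [[_ leKn] pK] fK; move: {-1}(n - deg f)%N (erefl (n - deg f)%N) => k.
elim: k f fK => [|k IHk] f fK eqk.
  exists f; split=> //; last exact: faces_refl.
  by apply/eqP; rewrite eqn_leq leKn // -subn_eq0 eqk.
have lt_fn : (deg f < n)%N by rewrite -subn_gt0 eqk.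
have [h hK fh] := pK f fK lt_fn.
have [|z [zK dz hz]] := IHk h hK.
  by apply/eqP; rewrite -eqSS -eqk (deg_bd fh) subnSK.
by exists z; split=> //; apply: faces_trans hz (bd_faces fh).
Qed.

Lemma eq_maximal K K' e : K =i K' -> maximal K e -> maximal K' e.
Proof.
move=> eqK [eK maxe]; split=> [|f]; first by rewrite -eqK.
by rewrite -eqK; apply: maxe.
Qed.

Lemma eq_has_order K K' n : K =i K' -> has_order K n -> has_order K' n.
Proof.
move=> eqK [[e eK de] leK]; split; first by exists e; rewrite -?eqK.
by move=> f; rewrite -eqK; apply: leK.
Qed.

Lemma eq_pure K K' n : K =i K' -> pure K n -> pure K' n.
Proof.
move=> eqK [oK pK]; split=> [|e]; first exact: eq_has_order oK.
rewrite -eqK => eK lt_en; have [f fK ef] := pK e eK lt_en.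
by exists f; rewrite -?eqK.
Qed.

Lemma eq_orders_maximal K K' s :
  K =i K' -> orders_maximal K s -> orders_maximal K' s.
Proof.
move=> eqK [s0 us maxs]; split=> // e; split=> [/maxs|maxe].
  exact: eq_maximal.
by apply/maxs; apply: eq_maximal maxe.
Qed.

Lemma has_order_inj K n n' : has_order K n -> has_order K n' -> n = n'.
Proof.
move=> [[e eK de] leK] [[e' e'K de'] leK']; apply/eqP.
by rewrite eqn_leq -{1}de -{2}de' leK // leK'.
Qed.

Lemma mem_skeleton i K e : (e \in skeleton i K) = (e \in K) && (deg e <= i)%N.
Proof. by []. Qed.

Lemma mem_bd_complex g e :
  (e \in bd_complex g) = (e \in faces g) && (deg e <= (deg g).-1)%N.
Proof. by []. Qed.

(** The conditions (S1)-(S3) at an element x of positive degree that comes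
    after the elements of s. *)
Definition shelling_step (s : seq (cell C)) x : Prop :=
  if s is [::] then exists t, shelling (bd_complex x) t
  else pure (attaching s x) (deg x).-1 /\
       exists2 t, shelling (bd_complex x) t & come_first (attaching s x) t.

Lemma shelling_maximal K s : shelling K s -> orders_maximal K s.
Proof. by case. Qed.

Lemma shelling_stepP K s x :
  shelling K s -> x \in s -> (0 < deg x)%N -> shelling_step (before s x) x.
Proof.
case=> [{}K {}s [_ leK] [_ _ maxs]|{}K {}s d _ _ _ S1 S2 S3] xs dx.
  by have [/leK] := (maxs x).1 xs; rewrite leqNgt dx.
have := S1 x xs; have := S2 x xs; have := S3 x xs.
rewrite /shelling_step; case: (before s x) => [|y t] S3x S2x S1x.
  exact: S3x.
by split; [exact: S1x|exact: S2x].
Qed.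

(** The conditions at single elements suffice for a shelling in every order,
    0 included, so that the two constructors need not be told apart. *)
Lemma shelling_intro K d s :
  has_order K d -> orders_maximal K s ->
  (forall x, x \in s -> (0 < deg x)%N -> shelling_step (before s x) x) ->
  shelling K s.
Proof.
case: d => [|d] oK maxs steps; first exact: Shelling0.
apply: (ShellingS _ oK) => // x xs + dx; have := steps x xs dx.
- by rewrite /shelling_step; case: (before s x) => // y t [].
- by rewrite /shelling_step; case: (before s x) => // y t [].
- by rewrite /shelling_step; case: (before s x).
Qed.

Lemma eq_shelling K K' s : K =i K' -> shelling K s -> shelling K' s.
Proof.
move=> eqK sh; have [d oK] : exists d, has_order K d.
  by case: sh => [L t oL _|L t d _ oL *]; [exists 0%N|exists d].
apply: (shelling_intro (eq_has_order eqK oK)).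
  exact: eq_orders_maximal (shelling_maximal sh).
by move=> x; apply: (shelling_stepP sh).
Qed.

Lemma mem_attaching (s : seq (cell C)) x f :
  (f \in attaching s x) = (f \in faces x) && has (fun h => f \in faces h) s.
Proof. by []. Qed.

Lemma eq_attaching (s t : seq (cell C)) x :
  (forall f, f \in faces x ->
     has (fun h => f \in faces h) s = has (fun h => f \in faces h) t) ->
  attaching s x =i attaching t x.
Proof.
move=> eq_st f; rewrite !mem_attaching.
by case fx: (f \in faces x) => //; apply: eq_st.
Qed.

(** This is how shelling conditions are carried from one list of maximal
    elements to another: of the elements before x, only the subcomplex along
    which x is attached matters. *)
Lemma eq_shelling_step (s t : seq (cell C)) x :
  (s == [::]) = (t == [::]) -> attaching s x =i attaching t x ->
  shelling_step s x -> shelling_step t x.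
Proof.
case: s t => [|h s] [|h' t] // _ eq_st [pS [u shu cfu]].
split; first exact: eq_pure pS.
by exists u => //; apply: eq_come_first cfu.
Qed.

(** Subcomplexes with the same elements may still differ as records, by the
    form of their predicate and their closure proof. This is needed to
    identify an iterated skeleton with a skeleton. *)
Lemma eq_regular K K' : K =i K' -> regular K -> regular K'.
Proof.
move=> eqK [d [o [m [b [oK [u me sp mx ms md bs bc oi dm db]]]]]].
have eqK' : K' =i K by move=> x; rewrite eqK.
exists d, o, m, b; split; first exact: eq_has_order oK.
split=> //.
- by move=> n e; rewrite me eqK.
- move=> n e eo; split=> [/(mx n e eo)|maxe]; first exact: eq_maximal.
  by apply/(mx n e eo); apply: eq_maximal maxe.
- exact: eq_shelling ms.
- by move=> n e eo maxe; apply: dm => //; apply: eq_maximal maxe.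
Qed.

(** Every face of e of lower degree is a face of an element of bd(e), so only
    the latter are maximal. As a shelling is never empty, a shellable e of
    positive degree has a nonzero boundary. *)
Lemma mem_bd_shelling n (e : 'I_(rk C n.+1)) (s : seq 'I_(rk C n)) :
  shelling (bd_complex (Cell e)) (map (@Cell R C n) s) ->
  [/\ s != [::], uniq s & s =i bdn e].
Proof.
move=> /shelling_maximal[s0 us maxs]; split.
- by case: (s) s0.
- by rewrite (map_inj_uniq (@Cell_inj n)) in us.
move=> f; rewrite -(mem_map (@Cell_inj n)); apply/idP/idP.
  by move=> /maxs[+ _]; rewrite mem_bd_complex mem_faces_bdn => /andP[].
rewrite -mem_bd => fe; apply/maxs; split=> [|h].
  by rewrite mem_bd_complex bd_faces //= leqnn.
rewrite mem_bd_complex => /andP[_ dh]; apply/negP => /deg_bd dh'.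
by rewrite dh' /= ltnn in dh.
Qed.

End Skeleta.

(** * The order induced on the boundaries *)

Section InducedOrder.
Variables (R : idomainType) (C : chain_complex R).
Variables (n : nat) (s : seq 'I_(rk C n.+1)).
Variable b : 'I_(rk C n.+1) -> seq 'I_(rk C n).
Hypothesis us : uniq s.
Hypothesis b_bdn : forall e, e \in s -> b e =i bdn e.

Lemma first_coface (x : 'I_(rk C n)) (e : 'I_(rk C n.+1)) :
  e \in s -> x \in bdn e ->
  exists s1 e0 s2, [/\ s = s1 ++ e0 :: s2, x \in bdn e0 &
    all (fun e' : 'I_(rk C n.+1) => x \notin bdn e') s1].
Proof.
move=> es xe.
have hs : has (fun e' : 'I_(rk C n.+1) => x \in bdn e') s.
  by apply/hasP; exists e.
case/split_find: hs => e0 s1 s2 xe0 nh; exists s1, e0, s2; split=> //.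
  by rewrite cat_rcons.
by rewrite all_predC.
Qed.

Lemma before_split (s1 s2 : seq 'I_(rk C n.+1)) e :
  s = s1 ++ e :: s2 -> before s e = s1.
Proof.
move=> es; move: us; rewrite es cat_uniq => /and3P[_ /norP[e1 _] _].
by rewrite before_cat_notin // /before /= eqxx cats0.
Qed.

Lemma mem_induced_order (x : 'I_(rk C n)) :
  reflect (exists2 e, e \in s & x \in bdn e)
          (x \in @induced_order _ _ n.+1 s b).
Proof.
apply: (iffP idP) => [/flatten_mapP[e es]|[e es xe]].
  by rewrite mem_filter b_bdn // => /andP[_ xe]; exists e.
have [s1 [e0 [s2 [es' xe0 all1]]]] := first_coface es xe.
apply/flatten_mapP; exists e0; first by rewrite es' mem_cat inE eqxx orbT.
rewrite mem_filter (before_split es') all1 b_bdn //.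
by rewrite es' mem_cat inE eqxx orbT.
Qed.

(** Whatever lies in the boundary of an element before e is listed in a block
    before that of e, where e is the first element with x in its boundary. *)
Lemma induced_order_before (x : 'I_(rk C n)) :
  x \in @induced_order _ _ n.+1 s b ->
  exists e, [/\ e \in s, x \in bdn e,
    forall e', e' \in before s e -> x \notin bdn e' &
    forall y, (y \in before (@induced_order _ _ n.+1 s b) x) =
      has (fun e' : 'I_(rk C n.+1) => y \in bdn e') (before s e)
      || (y \in before (b e) x)].
Proof.
case/mem_induced_order=> e' e's xe'.
have [s1 [e [s2 [es xe all1]]]] := first_coface e's xe'.
have bes := before_split es.
have e_s : e \in s by rewrite es mem_cat inE eqxx orbT.
have s1_s e1 : e1 \in s1 -> e1 \in s by rewrite es mem_cat => ->.
exists e; rewrite bes; split=> //; first exact: (allP all1).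
rewrite /induced_order {2}es map_cat flatten_cat /= bes.
set A := flatten _.
have memA y : (y \in A) = has (fun e' : 'I_(rk C n.+1) => y \in bdn e') s1.
  apply/flatten_mapP/hasP => -[e1 e1s].
    by rewrite mem_filter b_bdn ?s1_s // => /andP[_ ye1]; exists e1.
  move=> ye1.
  have [t1 [e2 [t2 [et ye2 all2]]]] := first_coface (s1_s _ e1s) ye1.
  have e2s : e2 \in s by rewrite et mem_cat inE eqxx orbT.
  exists e2; last by rewrite mem_filter (before_split et) all2 b_bdn.
  rewrite -bes /before in_take // leqNgt; apply/negP; rewrite ltnS => le_e'.
  have : e1 \in before s e2.
    rewrite /before in_take ?s1_s //; apply: (leq_trans _ le_e').
    by rewrite -in_take ?s1_s // -/(before s e) bes.
  by rewrite (before_split et) => /(allP all2); rewrite ye1.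
have xA : x \notin A by rewrite memA -all_predC.
move=> y; rewrite before_cat_notin // before_cat_in ?mem_filter ?all1 ?b_bdn //.
rewrite before_filter // mem_cat memA mem_filter.
rewrite -[X in X && _]/(all (predC _) s1) all_predC.
by case: has.
Qed.

End InducedOrder.

(** * The list of the maximal elements *)

Section MaximalList.
Variables (R : idomainType) (C : chain_complex R).
Variables (o : forall n, seq 'I_(rk C n)) (m : nat -> nat).

(** Split off from [maximal_list] because the maximal elements in low degrees
    are common to a complex and its skeleton. *)
Definition lower_maximal (d : nat) :=
  flatten [seq [seq Cell e | e <- drop (m n) (o n)] | n <- rev (iota 0 d)].

Lemma maximal_listE d :
  maximal_list d o m =
  [seq Cell e | e <- drop (m d) (o d)] ++ lower_maximal d.
Proof. by rewrite /maximal_list -addn1 iotaD /= rev_cat. Qed.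

Lemma mem_maximal_list d n (e : 'I_(rk C n)) :
  (Cell e \in maximal_list d o m) = (n <= d)%N && (e \in drop (m n) (o n)).
Proof.
apply/flatten_mapP/andP => [[k]|[le_nd ed]].
  rewrite mem_rev mem_iota /= add0n ltnS => le_kd /mapP[f fd eqf].
  have ekn := congr1 (@deg R C) eqf; rewrite /deg /= in ekn.
  by case: _ / ekn f fd eqf le_kd => f fd /Cell_inj -> le_nd.
exists n; first by rewrite mem_rev mem_iota /= add0n ltnS.
exact: map_f.
Qed.

Lemma descending_maximal_list d : descending (maximal_list d o m).
Proof.
rewrite /descending sorted_pairwise; last first.
  by move=> y x z /= le_yx le_zy; apply: leq_trans le_zy le_yx.
have pairwise_const n (s : seq 'I_(rk C n)) :
    pairwise (fun e f => deg f <= deg e)%N [seq Cell e | e <- s].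
  elim: s => //= e s ->; rewrite andbT.
  by apply/allP => _ /mapP[f _ ->].
elim: d => [|d IHd]; rewrite maximal_listE pairwise_cat.
  rewrite allrel0r /= andbT.
  exact: pairwise_const.
rewrite -/(maximal_list d o m) IHd andbT; apply/andP; split.
  apply/allrelP => _ [n f] /mapP[e _ ->].
  by rewrite -/(Cell f) mem_maximal_list => /andP[/leqW].
exact: pairwise_const.
Qed.

End MaximalList.

Lemma dependent_mono (R : idomainType) (C : chain_complex R) n
    (s t : seq 'I_(rk C n)) (x : 'I_(rk C n)) :
  uniq s -> uniq t -> {subset t <= s} -> x \notin s ->
  (exists a : 'I_(rk C n) -> R,
    a x != 0 /\ a x *: bdry x = \sum_(y <- t) a y *: bdry y) ->
  exists a : 'I_(rk C n) -> R,
    a x != 0 /\ a x *: bdry x = \sum_(y <- s) a y *: bdry y.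
Proof.
move=> us ut ts xs [a [ax0 axE]].
exists (fun y => if (y == x) || (y \in t) then a y else 0).
rewrite eqxx /=; split=> //; rewrite axE.
rewrite !big_uniq //= [RHS](bigID (mem t)) /= [X in _ + X]big1 => [|y].
  rewrite addr0; apply: eq_big => [y|y ->]; last by rewrite orbT.
  by case yt: (y \in t); rewrite ?andbF // ts.
move=> /andP[ys /negbTE ->]; rewrite orbF.
by case: eqP => [eyx|_]; [rewrite -eyx ys in xs | exact: scale0r].
Qed.

(** * Removing the top degree *)

Section RegularSkeleton.
Variables (R : idomainType) (C : chain_complex R).
Variables (K : subcomplex C) (d : nat) (o : forall n, seq 'I_(rk C n)).
Variables (m : nat -> nat) (b : forall n, 'I_(rk C n) -> seq 'I_(rk C n.-1)).
Hypotheses (oK : has_order K d.+1) (reg : regular_orders K d.+1 o m (@b)).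

Let facets := o d.+1.
Let ridges : seq 'I_(rk C d) := induced_order facets (@b d.+1).
Let tail := drop (m d) (o d).
Let bdord (e : 'I_(rk C d.+1)) : seq 'I_(rk C d) := b e.

Lemma order_ridges : o d = ridges ++ tail.
Proof. exact: order_induced reg _ (ltnSn d). Qed.

Lemma bdord_shelling e : e \in facets ->
  [/\ bdord e != [::], uniq (bdord e) & bdord e =i bdn e].
Proof.
move=> ef; apply: mem_bd_shelling.
exact: (bd_shelling reg (ltn0Sn d) ef).
Qed.

Lemma mem_bdord e : e \in facets -> bdord e =i bdn e.
Proof. by case/bdord_shelling. Qed.

Lemma mem_ridges x :
  reflect (exists2 e, e \in facets & x \in bdn e) (x \in ridges).
Proof. exact: mem_induced_order (order_uniq reg _) mem_bdord _. Qed.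

Lemma facet_maximal e : e \in facets -> maximal K (Cell e).
Proof.
rewrite (order_mem reg) => eK; split=> // f fK; apply/negP => /deg_bd df.
by have := oK.2 f fK; rewrite df ltnn.
Qed.

(** No basis element of degree d+2 could have a facet in its boundary, so all
    facets are maximal and none is cut off. *)
Lemma drop_facets : drop (m d.+1) facets = facets.
Proof.
have : (size facets <= size (drop (m d.+1) facets))%N.
  apply: uniq_leq_size (order_uniq reg _) _ => e ef.
  by apply/(order_maximal reg ef); apply: facet_maximal.
rewrite size_drop; case: (m d.+1) => [|k]; first by rewrite drop0.
by case: facets => //= e s; rewrite subSS ltnNge leq_subr.
Qed.

Let rest := [seq Cell e | e <- tail] ++ lower_maximal o m d.

Lemma maximal_list_facets :
  maximal_list d.+1 o m = [seq Cell e | e <- facets] ++ rest.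
Proof.
by rewrite /rest -maximal_listE maximal_listE drop_facets.
Qed.

Lemma facet_step e :
  e \in facets -> shelling_step [seq Cell e' | e' <- before facets e] (Cell e).
Proof.
move=> ef; have ef' : Cell e \in [seq Cell e' | e' <- facets] by apply: map_f.
rewrite -before_map; last exact: Cell_inj.
rewrite -(before_cat_in rest ef') -maximal_list_facets.
apply: (shelling_stepP (maximal_shelling reg)) => //.
by rewrite maximal_list_facets mem_cat ef'.
Qed.

Lemma old_ridge e z : e \in facets ->
  z \in attaching [seq Cell e' | e' <- before facets e] (Cell e) -> deg z = d ->
  exists y : 'I_(rk C d), [/\ z = Cell y, y \in bdord e &
    has (fun e' : 'I_(rk C d.+1) => y \in bdn e') (before facets e)].
Proof.
move=> ef; rewrite mem_attaching => /andP[ze hz] dz.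
have [y eqz ye] := faces_codim1 ze dz; exists y.
rewrite mem_bdord //; split=> //.
move: hz; rewrite eqz has_map; apply: sub_has => e' /=.
by rewrite mem_faces_bdn.
Qed.

(** In the shelling of bd(e) the ridges shared with earlier facets come first,
    hence before any ridge x that is new with e. *)
Lemma old_ridge_first e x y : e \in facets ->
  (forall e' : 'I_(rk C d.+1), e' \in before facets e -> x \notin bdn e') ->
  y \in bdord e ->
  has (fun e' : 'I_(rk C d.+1) => y \in bdn e') (before facets e) ->
  y \in before (bdord e) x.
Proof.
move=> ef newx ye oldy.
rewrite -(mem_map (@Cell_inj _ C d)) -before_map; last exact: Cell_inj.
apply: (come_first_before (bd_come_first reg (ltn0Sn d) ef)).
- rewrite mem_attaching negb_and has_map; apply/orP; right.
  by apply/hasPn => e' /newx; rewrite -mem_faces_bdn.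
- exact: map_f.
rewrite mem_attaching mem_faces_bdn -mem_bdord // ye has_map.
by apply: sub_has oldy => e' /=; rewrite mem_faces_bdn.
Qed.

(** The key comparison: x meets the ridges before it in the same faces as it
    meets those before it in the boundary of e, the first facet containing x.
    A face shared with a ridge outside bd(e) is moved into bd(e) by the purity
    of the subcomplex along which e is attached. *)
Lemma ridge_attaching x : x \in ridges -> exists e,
  [/\ e \in facets, x \in bdord e,
      {subset before (bdord e) x <= before ridges x},
      (before ridges x == [::]) = (before (bdord e) x == [::]) &
      forall f, f \in faces (Cell x) ->
        has (fun h => f \in faces h) [seq Cell y | y <- before ridges x] =
        has (fun h => f \in faces h) [seq Cell y | y <- before (bdord e) x]].
Proof.
move=> xr.
have [e [ef xe newx memr]] :=
  induced_order_before (order_uniq reg _) mem_bdord xr.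
have pure_att : before facets e != [::] ->
    pure (attaching [seq Cell e' | e' <- before facets e] (Cell e)) d.
  by have := facet_step ef; case: (before facets e) => // e1 s [].
have subr : {subset before (bdord e) x <= before ridges x}.
  by move=> y yb'; rewrite /ridges memr yb' orbT.
exists e; rewrite mem_bdord //; split=> //.
  (* Purity also provides an old ridge of e as soon as e is not the first
     facet, and that ridge precedes x in both orders. *)
  have [no_earlier|/pure_att[[[z zA dz] _] _]] := eqVneq (before facets e) [::].
    have eqr : before ridges x =i before (bdord e) x.
      by move=> y; rewrite /ridges memr no_earlier.
    case: (before ridges x) eqr => [|y s] eqr.
      by case: (before (bdord e) x) eqr => // y s /(_ y); rewrite !inE eqxx.
    by case: (before (bdord e) x) eqr => // /(_ y); rewrite !inE eqxx.
  have [y [_ ye oldy]] := old_ridge ef zA dz.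
  have yb' := old_ridge_first ef newx ye oldy.
  have := subr _ yb'; case: (before (bdord e) x) yb' => // y' s _.
  by case: (before ridges x).
move=> f fx; rewrite !has_map; apply/hasP/hasP => -[y /= yb fy]; last first.
  by exists y => //; apply: subr.
move: yb; rewrite /ridges memr => /orP[/hasP[e' e's ye']|]; last by exists y.
have ne : before facets e != [::] by case: (before facets e) e's.
have fA : f \in attaching [seq Cell e' | e' <- before facets e] (Cell e).
  rewrite mem_attaching; apply/andP; split.
    by apply: (faces_trans (e := Cell e) _ fx); rewrite mem_faces_bdn.
  rewrite has_map; apply/hasP; exists e' => //=.
  by apply: (faces_trans (e := Cell e') _ fy); rewrite mem_faces_bdn.
have [z [zA dz fz]] := pure_top (pure_att ne) fA.
have [y' [eqz y'e oldy']] := old_ridge ef zA dz.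
by exists y'; [apply: old_ridge_first|rewrite /= -eqz].
Qed.

(** In degree d every element of the skeleton is maximal, so its initial
    segment of non-maximal elements is empty. *)
Let o' n := if (n <= d)%N then o n else [::].
Let m' n := if (n < d)%N then m n else 0%N.

Lemma maximal_list_skeleton :
  maximal_list d o' m' = [seq Cell e | e <- ridges] ++ rest.
Proof.
rewrite maximal_listE /m' /o' ltnn leqnn drop0 order_ridges map_cat -catA.
congr (_ ++ (_ ++ _)); congr flatten; apply/eq_in_map => n.
by rewrite mem_rev mem_iota /= add0n => ltnd; rewrite ltnd ltnW.
Qed.

Lemma skeleton_maximal n (e : 'I_(rk C n)) : (n < d)%N ->
  maximal (skeleton d K) (Cell e) <-> maximal K (Cell e).
Proof.
move=> ltnd; split=> -[eK maxe]; split.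
- by move: eK; rewrite mem_skeleton => /andP[].
- move=> f fK; apply/negP => ef.
  have /negP[] // : Cell e \notin bd f.
  by apply: maxe; rewrite mem_skeleton fK (deg_bd ef).
- by rewrite mem_skeleton eK ltnW.
- by move=> f; rewrite mem_skeleton => /andP[/maxe].
Qed.

Lemma skeleton_maximal_ridge (e : 'I_(rk C d)) :
  e \in o d -> maximal (skeleton d K) (Cell e).
Proof.
move=> eo; split; first by rewrite mem_skeleton -(order_mem reg) eo leqnn.
move=> f; rewrite mem_skeleton => /andP[_ df]; apply/negP => /deg_bd df'.
by rewrite df' ltnn in df.
Qed.

Lemma ridge_in_order x : x \in ridges -> x \in o d.
Proof. by rewrite order_ridges mem_cat => ->. Qed.

Lemma facets_nonempty : facets != [::].
Proof.
have [[[k e] eK de] _] := oK; rewrite /deg /= in de.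
have : e \in o k by rewrite (order_mem reg).
by rewrite /facets -de; case: (o k).
Qed.

(** So the skeleton does have order d: the shelling of the boundary of a facet
    is nonempty. *)
Lemma ridges_nonempty : ridges != [::].
Proof.
have [e ef] : exists e, e \in facets.
  by case: facets facets_nonempty => // e s _; exists e; apply: mem_head.
have [b0 _ eqb] := bdord_shelling ef.
have [y yb'] : exists y, y \in bdord e.
  by case: (bdord e) b0 => // y s _; exists y; apply: mem_head.
have : y \in ridges by apply/mem_ridges; exists e; rewrite -?eqb.
by case: ridges.
Qed.

Lemma skeleton_has_order : has_order (skeleton d K) d.
Proof.
split; last by move=> e; rewrite mem_skeleton => /andP[].
have := ridge_in_order; case: ridges ridges_nonempty => // x s _.
move=> /(_ x (mem_head x s)) xo.
by exists (Cell x); rewrite // mem_skeleton -(order_mem reg) xo /=.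
Qed.

Lemma skeleton_mem n (e : 'I_(rk C n)) :
  (e \in o' n) = (Cell e \in skeleton d K).
Proof.
rewrite mem_skeleton -(order_mem reg) /o' /deg /=.
by case: leqP; rewrite ?andbT ?andbF.
Qed.

Lemma skeleton_maximalP n (e : 'I_(rk C n)) : e \in o' n ->
  e \in drop (m' n) (o' n) <-> maximal (skeleton d K) (Cell e).
Proof.
rewrite /o' /m'; case: ltngtP => // [ltnd|eqnd] eo.
  exact: iff_trans (order_maximal reg eo) (iff_sym (skeleton_maximal _ ltnd)).
case: _ / (esym eqnd) e eo => e eo; rewrite drop0 eo.
by split=> // _; apply: skeleton_maximal_ridge.
Qed.

Lemma ridge_not_maximal x : x \in ridges -> ~ maximal K (Cell x).
Proof.
case/mem_ridges=> e ef xe [_ maxx].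
have /negP[] : Cell x \notin bd (Cell e).
  by apply: maxx; rewrite -(order_mem reg).
by rewrite mem_bd.
Qed.

Lemma rest_maximal x : x \in rest -> maximal K x /\ (deg x <= d)%N.
Proof.
move=> xT; split.
  have [_ _ max] := shelling_maximal (maximal_shelling reg).
  by apply/max; rewrite maximal_list_facets mem_cat xT orbT.
move: xT; rewrite /rest -maximal_listE; case: x => n e.
by rewrite -/(Cell e) mem_maximal_list => /andP[].
Qed.

Lemma rest_notin_ridges x : x \in rest -> x \notin [seq Cell e | e <- ridges].
Proof.
case/rest_maximal=> maxx _; apply/negP => /mapP[y yr eqx].
by apply: (ridge_not_maximal yr); rewrite -eqx.
Qed.

Lemma skeleton_orders_maximal :
  orders_maximal (skeleton d K) ([seq Cell e | e <- ridges] ++ rest).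
Proof.
split.
- by case: ridges ridges_nonempty.
- have := order_uniq reg d; rewrite order_ridges cat_uniq => /andP[ur _].
  rewrite cat_uniq (map_inj_uniq (@Cell_inj _ C d)) ur /=.
  have [_ + _] := shelling_maximal (maximal_shelling reg).
  rewrite maximal_list_facets cat_uniq => /and3P[_ _ ->]; rewrite andbT.
  by apply/hasPn => x; apply: rest_notin_ridges.
case=> n e; rewrite -maximal_list_skeleton -/(Cell e) mem_maximal_list.
split=> [/andP[_ ed]|maxe].
  by apply/skeleton_maximalP => //; apply: mem_drop ed.
have eo : e \in o' n by rewrite skeleton_mem; case: maxe.
have -> : e \in drop (m' n) (o' n) by apply/skeleton_maximalP.
by case: maxe; rewrite mem_skeleton => /andP[_ ->].
Qed.

(** Passing from a facet down to a proper face, the first step already reaches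
    a ridge. *)
Lemma has_faces_ridges f : (deg f <= d)%N ->
  has (fun h => f \in faces h) [seq Cell e | e <- ridges] =
  has (fun h => f \in faces h) [seq Cell e | e <- facets].
Proof.
move=> df; rewrite !has_map; apply/hasP/hasP => -[y /= yb fy].
  have [e ef ye] := mem_ridges _ yb; exists e => //=.
  by apply: (faces_trans (e := Cell e) _ fy); rewrite mem_faces_bdn.
have [h hy fh] := faces_bd_first fy df.
have dh : deg h = d by apply/eqP; rewrite -eqSS -(deg_bd hy).
have [z eqz zy] := faces_codim1 (bd_faces hy) dh.
by exists z; rewrite /= -?eqz //; apply/mem_ridges; exists y.
Qed.

Lemma skeleton_shelling :
  shelling (skeleton d K) ([seq Cell e | e <- ridges] ++ rest).
Proof.
apply: shelling_intro skeleton_has_order skeleton_orders_maximal _ => x.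
rewrite mem_cat => xrt dx.
have [xr|xr] := boolP (x \in [seq Cell e | e <- ridges]).
  rewrite before_cat_in //; case/mapP: xr dx => y yr -> dy.
  rewrite before_map; last exact: Cell_inj.
  have [e [ef ye _ nilE eqhas]] := ridge_attaching yr.
  have := shelling_stepP (bd_shelling reg (ltn0Sn d) ef) (map_f _ ye) dy.
  rewrite before_map; last exact: Cell_inj.
  apply: eq_shelling_step.
    move: nilE; rewrite /bdord.
    by case: (before ridges y) (before (b e) y) => [|? ?] [].
  by apply: eq_attaching => f /eqhas.
rewrite (negbTE xr) /= in xrt; have [_ le_xd] := rest_maximal xrt.
have xf : x \notin [seq Cell e | e <- facets].
  by apply/negP => /mapP[e _ eqx]; rewrite eqx /deg /= ltnn in le_xd.
have xold : x \in [seq Cell e | e <- facets] ++ rest.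
  by rewrite mem_cat xrt orbT.
have := maximal_shelling reg; rewrite maximal_list_facets => /shelling_stepP.
move=> /(_ x xold dx).
rewrite (before_cat_notin rest xf) (before_cat_notin rest xr).
apply: eq_shelling_step.
  by case: facets facets_nonempty => // e s _; case: ridges ridges_nonempty.
apply: eq_attaching => f fx; rewrite !has_cat has_faces_ridges //.
exact: leq_trans (faces_deg fx) le_xd.
Qed.

(** A ridge covered by the ridges before it is covered by those before it in
    the boundary of its first facet e, because it meets both families in the
    same faces; the relation given by (R2) for bd(e) is extended by zero. *)
Lemma ridge_dependent x :
  x \in ridges -> dependent_if_covered (before (o d) x) x.
Proof.
move=> xr cov; have xo := ridge_in_order xr.
have bx : before (o d) x = before ridges x.
  by rewrite order_ridges before_cat_in.
have [e [ef xe subr _ eqhas]] := ridge_attaching xr.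
have [_ ub _] := bdord_shelling ef.
apply: (@dependent_mono _ _ _ _ (before (bdord e) x)).
- exact: take_uniq (order_uniq reg d).
- exact: take_uniq.
- by rewrite bx.
- exact: before_notin.
apply: (bd_dependent reg (ltn0Sn d) ef xe); rewrite [d.+1.-1]/= => f fx.
have [y yb fy] := cov f fx; rewrite bx in yb.
have bdE z := mem_faces_bdn_pred z fx.
have := eqhas (Cell f); rewrite bdE fx => /(_ isT); rewrite !has_map => hasE.
have : has (preim (@Cell R C d) (fun h => Cell f \in faces h))
           (before (bdord e) x).
  by rewrite -hasE; apply/hasP; exists y; rewrite //= bdE.
by case/hasP=> z zb /=; rewrite bdE => fz; exists z.
Qed.

Lemma skeleton_regular_orders : regular_orders (skeleton d K) d o' m' (@b).
Proof.
have o'_sub n (e : 'I_(rk C n)) : e \in o' n -> (n <= d)%N /\ o' n = o n.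
  by rewrite /o'; case: leqP.
split.
- by move=> n; rewrite /o'; case: ifP => // _; apply: order_uniq reg _.
- exact: skeleton_mem.
- move=> n; rewrite /o' /m'; case: ltngtP => // _; exact: order_split reg _.
- exact: skeleton_maximalP.
- by rewrite maximal_list_skeleton; apply: skeleton_shelling.
- exact: descending_maximal_list.
- move=> n e n0 eo; have [_ eqo] := o'_sub n e eo; rewrite eqo in eo.
  exact: bd_shelling reg _ _ n0 eo.
- move=> n e n0 eo; have [_ eqo] := o'_sub n e eo; rewrite eqo in eo *.
  exact: bd_come_first reg _ _ n0 eo.
- move=> n ltnd; rewrite /o' /m' ltnd ltnW //.
  by apply: order_induced reg _ _; apply: leqW.
- move=> n e eo maxe; have [le_nd eqo] := o'_sub n e eo; rewrite eqo in eo *.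
  move: le_nd; rewrite leq_eqVlt => /orP[/eqP eqnd|ltnd]; last first.
    by apply: (maximal_dependent reg) => //; apply/skeleton_maximal.
  case: _ / (esym eqnd) e eo {maxe eqo} => e eo.
  move: (eo); rewrite order_ridges mem_cat -order_ridges => /orP[|eD].
    exact: ridge_dependent.
  by apply: (maximal_dependent reg) => //; apply/(order_maximal reg eo).
- move=> n e f n0 eo; have [_ eqo] := o'_sub n e eo; rewrite eqo in eo.
  exact: bd_dependent reg _ _ _ n0 eo.
Qed.

End RegularSkeleton.

Lemma regular_skeleton_pred (R : idomainType) (C : chain_complex R)
    (K : subcomplex C) d :
  has_order K d.+1 -> regular K ->
  has_order (skeleton d K) d /\ regular (skeleton d K).
Proof.
move=> oK [d' [o [m [b [oK' reg]]]]].
move: reg; rewrite -(has_order_inj oK oK') => reg.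
have oS := skeleton_has_order oK reg; split=> //.
exists d; do 3!eexists; split=> //; exact: skeleton_regular_orders oK reg.
Qed.

Lemma regular_skeleton (R : idomainType) (C : chain_complex R)
    (K : subcomplex C) d i :
  (i <= d)%N -> has_order K d -> regular K -> regular (skeleton i K).
Proof.
elim: d K => [|d IHd] K le_id oK regK.
  apply: eq_regular regK => x; rewrite mem_skeleton.
  by case xK: (x \in K) => //=; rewrite (leq_trans (oK.2 x xK)).
have [ei|ne_id] := eqVneq i d.+1.
  apply: eq_regular regK => x; rewrite mem_skeleton.
  by case xK: (x \in K) => //=; rewrite ei oK.2.
have {ne_id}le_id' : (i <= d)%N by rewrite -ltnS ltn_neqAle ne_id.
have [oS regS] := regular_skeleton_pred oK regK.
apply: eq_regular (IHd _ le_id' oS regS) => x; rewrite !mem_skeleton -andbA.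
congr (_ && _); case le_xi: (deg x <= i)%N; last exact: andbF.
by rewrite (leq_trans le_xi).
Qed.

Theorem corollary6p8 (R : idomainType) (hR : principal_ring R)
    (C : chain_complex R) (d : nat)
    (hd : has_order (full C) d) (hC : regular (full C)) (i : nat)
    (hi : (i <= d)%N) :
  regular (skeleton i (full C)).
Proof. exact: regular_skeleton hi hd hC. Qed.
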